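(* Let $H_{\mathbb{Z}}=\{(x,y,z)\in\mathbb{Z}^3:2xz-y^2=1\}$, and for $v\in H_{\mathbb{Z}}$ let $\Lambda_v=v^\perp\cap\mathbb{Z}^3$, where $v^\perp$ is the Euclidean orthogonal complement of $v$ in $\mathbb{R}^3$. Then the set of shapes $\{\mathrm{s}(\Lambda_v):v\in H_{\mathbb{Z}}\}$ is dense in $\mathrm{PO}(2)\backslash X_2$.
   Context: $X_2\cong\mathrm{PGL}(2,\mathbb{R})/\mathrm{PGL}(2,\mathbb{Z})$ denotes the space of full-rank lattices in $\mathbb{R}^2$ up to scaling, and $\mathrm{PO}(2)\backslash X_2$ its quotient by rotations and reflections. For a rank-$2$ discrete subgroup $\Lambda\subseteq\mathbb{R}^3$, its shape $\mathrm{s}(\Lambda)\in\mathrm{PO}(2)\backslash X_2$ is the equivalence class of $\Lambda$ under scaling and orthogonal transformations of $\mathbb{R}^3$; concretely, one maps $\mathrm{Span}_{\mathbb{R}}(\Lambda)$ to $\mathbb{R}^2$ by a linear isometry and takes the class of the image lattice in $\mathrm{PO}(2)\backslash X_2$. *)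

(* Defs.v *)
From HB Require Import structures.
From mathcomp Require Import all_boot all_order all_algebra.
From mathcomp Require Import generic_quotient.
From mathcomp Require Import all_classical all_reals all_analysis.

Set Implicit Arguments.
Unset Strict Implicit.
Unset Printing Implicit Defensive.

Import Order.TTheory GRing.Theory Num.Theory.
Import numFieldNormedType.Exports.

Local Open Scope classical_set_scope.
Local Open Scope ring_scope.
Local Open Scope quotient_scope.

(* The library norm on matrices is the sup norm; the Euclidean one is needed. *)
Definition dot {R : realType} {n : nat} (u v : 'cV[R]_n) : R :=
  \sum_i u i 0 * v i 0.

Definition enorm {R : realType} {n : nat} (u : 'cV[R]_n) : R :=
  Num.sqrt (dot u u).

Definition intpoints (R : realType) (n : nat) : set 'cV[R]_n :=
  range (map_mx intr : 'cV[int]_n -> 'cV[R]_n).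

Arguments intpoints : clear implicits.

Definition Rspan {R : realType} {n : nat} (A : set 'cV[R]_n) : set 'cV[R]_n :=
  [set w | exists k (a : 'I_k -> R) (u : 'I_k -> 'cV[R]_n),
     (forall i, A (u i)) /\ w = \sum_i a i *: u i].

(* GL(2, R), topologized as a subspace of 'M[R]_2. The matrix g stands for    *)
(* the lattice spanned by its columns.                                        *)
Definition GL2 (R : realType) : Type :=
  set_type [set M : 'M[R]_2 | M \in unitmx].

HB.instance Definition _ (R : realType) := Topological.on (GL2 R).

Definition mkGL2 {R : realType} (M : 'M[R]_2) (uM : M \in unitmx) : GL2 R :=
  exist (fun N => N \in [set N : 'M[R]_2 | N \in unitmx]) M (mem_set uM).

Definition col_lattice {R : realType} (g : GL2 R) : set 'cV[R]_2 :=
  mulmx (val g) @` intpoints R 2.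

(* PGL(2, R) / PGL(2, Z), obtained from GL(2, R) by dividing at once by the   *)
(* scalars R^* and by the right action of GL(2, Z).                           *)
Definition X2_rel {R : realType} (g h : GL2 R) : bool :=
  `[< exists (c : R) (gam : 'M[int]_2),
      [/\ c != 0, gam \in unitmx
        & val h = c *: (val g *m map_mx intr gam)] >].

Lemma X2_rel_refl R : reflexive (@X2_rel R).
Proof.
move=> g; apply/asboolP; exists 1, 1%:M; split; rewrite ?oner_neq0 ?unitmx1//.
by rewrite map_mx1 mulmx1 scale1r.
Qed.

Lemma X2_rel_sym R : symmetric (@X2_rel R).
Proof.
suff H : forall g h : GL2 R, X2_rel g h -> X2_rel h g.
  by move=> g h; apply/idP/idP; apply: H.
move=> g h /asboolP[c [gam [c0 ug hE]]]; apply/asboolP.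
exists c^-1, (invmx gam); split; rewrite ?invr_eq0 ?unitmx_inv//.
rewrite hE -scalemxAl scalerA mulVf// scale1r -mulmxA -map_mxM mulmxV//.
by rewrite map_mx1 mulmx1.
Qed.

Lemma X2_rel_trans R : transitive (@X2_rel R).
Proof.
move=> h g k /asboolP[c [gam [c0 ug hE]]] /asboolP[d [del [d0 ud kE]]].
apply/asboolP; exists (d * c), (gam *m del); split.
- by rewrite mulf_neq0.
- by rewrite unitmx_mul ug.
- by rewrite kE hE -scalemxAl scalerA map_mxM mulmxA.
Qed.

Definition X2_equiv (R : realType) : equiv_rel (GL2 R) :=
  EquivRel (@X2_rel R) (@X2_rel_refl R) (@X2_rel_sym R) (@X2_rel_trans R).

Definition X2 (R : realType) : Type :=
  quotient_topology {eq_quot (X2_equiv R)}.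

HB.instance Definition _ (R : realType) := Topological.on (X2 R).
HB.instance Definition _ (R : realType) := Quotient.on (X2 R).

Definition O2 (R : realType) : set 'M[R]_2 :=
  [set k | k *m k^T = 1%:M].

Arguments O2 : clear implicits.

(* Being in the same orbit of O(2), which acts through PO(2).                 *)
Definition shape_rel {R : realType} (x y : X2 R) : bool :=
  `[< exists (k : 'M[R]_2) (g h : GL2 R),
      [/\ O2 R k, \pi_(X2 R) g = x, \pi_(X2 R) h = y
        & val h = k *m val g] >].

Lemma shape_rel_refl R : reflexive (@shape_rel R).
Proof.
move=> x; apply/asboolP; exists 1%:M, (repr x), (repr x).
by split; rewrite ?reprK ?mul1mx// /O2 /= trmx1 mulmx1.
Qed.

Lemma shape_rel_sym R : symmetric (@shape_rel R).
Proof.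
suff H : forall x y : X2 R, shape_rel x y -> shape_rel y x.
  by move=> x y; apply/idP/idP; apply: H.
move=> x y /asboolP[k [g [h [kO gx hy hE]]]]; apply/asboolP.
have kO' := mulmx1C kO.
by exists k^T, h, g; split; rewrite // ?hE ?mulmxA ?kO' ?mul1mx // /O2/= trmxK.
Qed.

Lemma X2P (R : realType) (g h : GL2 R) :
  reflect (\pi_(X2 R) g = \pi_(X2 R) h) (X2_rel g h).
Proof.
have H := @eqquotP _ (X2_equiv R) {eq_quot (X2_equiv R)} g h.
exact: H.
Qed.

Lemma shape_rel_trans R : transitive (@shape_rel R).
Proof.
move=> y x z /asboolP[k [g [h [kO gx hy hE]]]].
move=> /asboolP[l [g' [h' [lO gy hz h'E]]]].
have /X2P/asboolP[c [gam [c0 ug g'E]]] : \pi_(X2 R) h = \pi_(X2 R) g'.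
  by rewrite hy gy.
have uf : c *: (val g *m map_mx intr gam) \in unitmx.
  rewrite unitmxZ ?unitfE// unitmx_mul; apply/andP; split.
    by have := valP g; rewrite inE.
  by rewrite unitmxE det_map_mx rmorph_unit// -unitmxE.
apply/asboolP; exists (l *m k), (mkGL2 uf), h'; split=> //.
- by rewrite /O2 /= trmx_mul mulmxA -(mulmxA l) kO mulmx1.
- rewrite -gx; apply/esym/X2P/asboolP; exists c, gam; split=> //.
- by rewrite /= h'E g'E hE -!scalemxAr !mulmxA.
Qed.

Definition shape_equiv (R : realType) : equiv_rel (X2 R) :=
  EquivRel (@shape_rel R)
    (@shape_rel_refl R) (@shape_rel_sym R) (@shape_rel_trans R).

Definition shape_space (R : realType) : Type :=
  quotient_topology {eq_quot (shape_equiv R)}.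

HB.instance Definition _ (R : realType) := Topological.on (shape_space R).
HB.instance Definition _ (R : realType) := Quotient.on (shape_space R).

Definition shape_class {R : realType} (g : GL2 R) : shape_space R :=
  \pi_(shape_space R) (\pi_(X2 R) g).

(* Linear maps on the span of L are represented by linear maps on R^3, to     *)
(* which they all extend; only the restriction to the span matters.           *)
Definition has_shape {R : realType} (L : set 'cV[R]_3) (s : shape_space R) :=
  exists (f : {linear 'cV[R]_3 -> 'cV[R]_2}) (g : GL2 R),
    [/\ forall u, Rspan L u -> enorm (f u) = enorm u,
        f @` L = col_lattice g
      & s = shape_class g].

(* The default value is irrelevant: it is taken only when L is not a          *)
(* discrete subgroup of rank 2.                                               *)
Definition lattice_shape {R : realType} (L : set 'cV[R]_3) : shape_space R :=
  xget (shape_class (mkGL2 (unitmx1 R 2))) [set s | has_shape L s].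

Definition HZ : set 'cV[int]_3 :=
  [set v | 2 * v 0 0 * v 2 0 - v 1 0 ^+ 2 = 1].

Definition Lambda (R : realType) (v : 'cV[int]_3) : set 'cV[R]_3 :=
  [set w | dot (map_mx intr v) w = 0] `&` intpoints R 3.

Arguments Lambda : clear implicits.

(* Main.v *)
Require Import Defs.
From mathcomp Require Import all_boot all_order all_algebra.
From mathcomp Require Import generic_quotient.
From mathcomp Require Import all_classical all_reals all_analysis.
From mathcomp Require Import ring lra.

Set Implicit Arguments.
Unset Strict Implicit.
Unset Printing Implicit Defensive.

Import Order.TTheory GRing.Theory Num.Theory.
Import numFieldNormedType.Exports.

Local Open Scope classical_set_scope.
Local Open Scope ring_scope.
Local Open Scope quotient_scope.

(** The shape of the plane lattice spanned by two vectors u, v of R^3 is the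
    similarity class of the lattice with basis (1, 0), (x, y), where
    x = <u, v> / |u|^2 and y = |u x v| / |u|^2, because a shape depends only on
    a Gram matrix up to scaling [shape_class_gram].  Every point of the shape
    space is of this form with y > 0 [shape_class_tri].  If u, v are integral
    and w = u x v lies on the quadric 2XZ - Y^2 = 1, then u, v is a basis of
    Lambda_w [Lambda_cross].  So it suffices to make (x, y) approximate an
    arbitrary point of the upper half plane by such integral pairs
    [integer_approx].

    The pairs come from an explicit family.  For an odd number s = 2l + 1 put
    m = (s^2 + 1) / 2.  Then (m, s, 1) is on the quadric, and so is its image
    w = (m, s + 2km, 1 + 2ks + 2k^2 m) under the unipotent isometry
    (X, Y, Z) |-> (X, Y + 2kX, Z + 2kY + 2k^2 X).  The vector
    f = (s + 2km, -m, 0) is orthogonal to w, and when k = s - j so is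
    b = (2 (1 + jk), k - j, -1); moreover w = f x b, so (b, a b - f) is a basis
    of Lambda_w for every integer a.  When l, j and k tend to infinity
    at comparable rates, |w| / |b|^2 tends to lim (l / j)^2, and x differs from
    a - m / j by o(1).  With l = p q n + i, j = q^2 n and a = 2 p^2 n + e the
    unbounded parts of a and m / j cancel, and as n tends to infinity
    (x, y) tends to (e - 2 p (2 i + 1) / q, (p / q)^2) [fam_limit].

    These limits are dense: if q is an odd prime and p is prime to q, then
    e q - 4 p i takes every integral value, so the first coordinate takes all
    values in (1 / q) Z, while p / q may be chosen within 1 / q of any given
    real number [rational_approx]. *)

(** * Shapes and Gram matrices *)

Lemma unit_val (R : realType) (g : GL2 R) : val g \in unitmx.
Proof. by have := valP g; rewrite inE. Qed.

Lemma int_unitmx (R : realType) n (gam : 'M[int]_n) :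
  gam \in unitmx -> (map_mx intr gam : 'M[R]_n) \in unitmx.
Proof. by move=> ug; rewrite unitmxE det_map_mx rmorph_unit// -unitmxE. Qed.

(** The linear map carrying the columns of c g gam to those of h is orthogonal,
    because both bases have the same Gram matrix. *)
Lemma shape_class_gram (R : realType) (g h : GL2 R) (c : R)
    (gam : 'M[int]_2) :
  c != 0 -> gam \in unitmx ->
  (val h)^T *m val h =
    c ^+ 2 *: ((val g *m map_mx intr gam)^T *m (val g *m map_mx intr gam)) ->
  shape_class g = shape_class h.
Proof.
move=> c0 ugam ghE.
have ug' : c *: (val g *m map_mx intr gam) \in unitmx.
  by rewrite unitmxZ ?unitfE// unitmx_mul unit_val int_unitmx.
pose g' := mkGL2 ug'.
have gg' : \pi_(X2 R) g = \pi_(X2 R) g'.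
  by apply/X2P/asboolP; exists c, gam.
have hg' : (val h)^T *m val h = (val g')^T *m val g'.
  by rewrite ghE /= [(c *: _)^T]linearZ /= -scalemxAl -scalemxAr scalerA.
rewrite /shape_class gg'; apply/eqquotP/asboolP.
exists (val h *m invmx (val g')), g', h; split=> //; last first.
  by rewrite mulmxKV ?unit_val.
rewrite /O2 /=; apply: mulmx1C.
rewrite trmx_mul -mulmxA (mulmxA _ (val h)) hg' -!mulmxA mulmxV ?unit_val//.
by rewrite mulmx1 -trmx_mul mulmxV ?unit_val// trmx1.
Qed.

Lemma ord2P (P : 'I_2 -> Prop) : P 0 -> P 1 -> forall i, P i.
Proof.
move=> P0 P1 i; case: (unliftP 0 i) => [j|] -> //.
by rewrite (ord1 j) (_ : lift _ _ = 1) //; apply/val_inj.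
Qed.

Lemma det2 (A : comNzRingType) (M : 'M[A]_2) :
  \det M = M 0 0 * M 1 1 - M 0 1 * M 1 0.
Proof.
rewrite (expand_det_row _ 0) !big_ord_recl big_ord0 /cofactor !det_mx11 !mxE /=.
rewrite (_ : lift 0 0 = 1); last exact/val_inj.
rewrite (_ : lift 1 0 = 0); last exact/val_inj.
by rewrite expr0 expr1 mul1r mulN1r mulrN addr0.
Qed.

(** The lattice spanned by (1, 0) and (x, y): the point x + i y of the upper
    half plane. *)
Definition tri {R : realType} (x y : R) : 'M[R]_2 :=
  \matrix_(i < 2, j < 2) if i == 0 then (if j == 0 then 1 else x)
                         else (if j == 0 then 0 else y).

Lemma tri_unit (R : realType) (x y : R) : 0 < y -> tri x y \in unitmx.
Proof.
by move=> y0; rewrite unitmxE unitfE det2 !mxE /= mulr0 subr0 mul1r gt_eqF.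
Qed.

Definition triGL (R : realType) (x y : R) (y0 : 0 < y) : GL2 R :=
  mkGL2 (tri_unit x y0).

(** Up to the factor a this is the Cholesky factorization of M. *)
Lemma gram_tri (R : realType) (M : 'M[R]_2) (a b d y : R) :
  M^T = M -> M 0 0 = a -> M 0 1 = b -> M 1 1 = d -> 0 < a ->
  (a * y) ^+ 2 = a * d - b ^+ 2 ->
  (tri (b / a) y)^T *m tri (b / a) y = a^-1 *: M.
Proof.
move=> sM M00 M01 M11 a0 yE.
have M10 : M 1 0 = b by rewrite -sM mxE.
have a1 : a != 0 by rewrite gt_eqF.
have yE' : y ^+ 2 = (a * d - b ^+ 2) / a ^+ 2.
  by rewrite -yE exprMn mulrC mulKf// expf_neq0.
apply/matrixP; elim/ord2P; elim/ord2P;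
  rewrite !mxE !big_ord_recl big_ord0 !mxE /= ?(M00, M01, M10, M11).
all: rewrite ?(mulr0, mul0r, mul1r, mulr1, addr0, add0r) -?expr2 ?yE'.
all: by field.
Qed.

Lemma gram00_gt0 (R : realType) m (B : 'M[R]_(m, 2)) :
  B^T *m B \in unitmx -> 0 < (B^T *m B) 0 0.
Proof.
move=> uB; have G00 : (B^T *m B) 0 0 = \sum_i B i 0 ^+ 2.
  by rewrite mxE; apply: eq_bigr => i _; rewrite mxE.
rewrite lt_neqAle eq_sym G00 sumr_ge0 ?andbT; last first.
  by move=> i _; apply: sqr_ge0.
apply/eqP => /eqP; rewrite psumr_eq0; last by move=> i _; apply: sqr_ge0.
move=> /allP B0; have {}B0 i : B i 0 = 0.
  by apply/eqP; rewrite -sqrf_eq0; apply: B0; rewrite mem_index_enum.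
have G0 j : (B^T *m B) 0 j = 0.
  by rewrite mxE big1// => i _; rewrite mxE B0 mul0r.
by move: uB; rewrite unitmxE det2 !G0 !mul0r subrr unitr0.
Qed.

Lemma shape_class_tri (R : realType) (g : GL2 R) :
  exists (x y : R) (y0 : 0 < y), shape_class g = shape_class (triGL x y0).
Proof.
pose G := (val g)^T *m val g.
have uG : G \in unitmx by rewrite unitmx_mul unitmx_tr unit_val.
have a0 := gram00_gt0 uG; rewrite -/G in a0.
have dG : \det G = \det (val g) ^+ 2 by rewrite det_mulmx det_tr expr2.
have d0 : \det (val g) != 0 by have := unit_val g; rewrite unitmxE unitfE.
have y0 : 0 < `|\det (val g)| / G 0 0 by rewrite divr_gt0 ?normr_gt0.
have sG : G^T = G by rewrite trmx_mul trmxK.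
exists (G 0 1 / G 0 0), _, y0.
apply: (@shape_class_gram _ _ _ (Num.sqrt (G 0 0))^-1 1%:M).
- by rewrite invr_eq0 gt_eqF// sqrtr_gt0.
- exact: unitmx1.
rewrite map_mx1 mulmx1 exprVn sqr_sqrtr ?ltW//.
apply: (gram_tri sG) => //.
have G10 : G 1 0 = G 0 1 by rewrite -{1}sG mxE.
by rewrite mulrC divfK ?gt_eqF// real_normK ?num_real// -dG det2 G10 expr2.
Qed.

(** * The shape of a lattice given by a basis *)

Lemma col_delta (R : realType) m n (B : 'M[R]_(m, n)) j :
  (mulmx B @` intpoints R n) (col j B).
Proof.
exists (delta_mx j 0); last by rewrite colE.
by exists (delta_mx j 0) => //; rewrite map_delta_mx.
Qed.

Lemma col_factor_int (R : realType) m n k (M : 'M[R]_(m, n))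
    (N : 'M[R]_(m, k)) :
  (forall j, (mulmx M @` intpoints R n) (col j N)) ->
  exists gam : 'M[int]_(n, k), N = M *m map_mx intr gam.
Proof.
move=> MN; have [z zE] : {z : 'I_k -> 'cV[int]_n &
    forall j, M *m map_mx intr (z j) = col j N}.
  apply: (@choice _ _ (fun j (z : 'cV[int]_n) => M *m map_mx intr z = col j N)).
  by move=> j; have [_ [z _ <-] <-] := MN j; exists z.
exists (\matrix_(i, j) z j i 0); apply/matrixP => i j.
have /colP /(_ i) := zE j; rewrite [RHS]mxE => <-.
by rewrite !mxE; apply: eq_bigr => l _; rewrite !mxE.
Qed.

(** The two factorizations N = M gam and M = N del force gam del = 1. *)
Lemma lattice_bases (R : realType) n (M N : 'M[R]_n) : M \in unitmx ->
  mulmx N @` intpoints R n = mulmx M @` intpoints R n ->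
  exists2 gam : 'M[int]_n, gam \in unitmx & N = M *m map_mx intr gam.
Proof.
move=> uM NM.
have [gam NE] : exists gam : 'M[int]_n, N = M *m map_mx intr gam.
  by apply: col_factor_int => j; rewrite -NM; apply: col_delta.
have [del ME] : exists del : 'M[int]_n, M = N *m map_mx intr del.
  by apply: col_factor_int => j; rewrite NM; apply: col_delta.
exists gam => //; suff /mulmx1_unit[] : gam *m del = 1%:M by [].
have := ME; rewrite NE -mulmxA -map_mxM => /(congr1 (mulmx (invmx M))).
rewrite mulKmx// mulVmx// -(map_mx1 intr) => /matrixP E.
by apply/matrixP => i j; have /esym := E i j; rewrite !mxE => /intr_inj.
Qed.

Lemma dotE (R : realType) n (u v : 'cV[R]_n) : dot u v = (u^T *m v) 0 0.
Proof. by rewrite mxE; apply: eq_bigr => i _; rewrite mxE. Qed.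

Lemma dotD (R : realType) n (u v : 'cV[R]_n) :
  dot (u + v) (u + v) = dot u u + 2 * dot u v + dot v v.
Proof.
rewrite /dot mulr_sumr -!big_split /=; apply: eq_bigr => i _.
by rewrite !mxE; ring.
Qed.

Lemma dot_ge0 (R : realType) n (u : 'cV[R]_n) : 0 <= dot u u.
Proof. by apply: sumr_ge0 => i _; rewrite -expr2 sqr_ge0. Qed.

Lemma dot_enorm (R : realType) n (u : 'cV[R]_n) : dot u u = enorm u ^+ 2.
Proof. by rewrite sqr_sqrtr ?dot_ge0. Qed.

Lemma linear_colE (R : realType) m n k (B : 'M[R]_(m, n))
    (f : {linear 'cV[R]_m -> 'cV[R]_k}) (a : 'cV[R]_n) :
  f (B *m a) = (\matrix_(i, j) f (col j B) i 0) *m a.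
Proof.
have -> : B *m a = \sum_j a j 0 *: col j B.
  apply/colP => i; rewrite mxE summxE; apply: eq_bigr => j _.
  by rewrite !mxE mulrC.
rewrite linear_sum; apply/colP => i; rewrite mxE summxE; apply: eq_bigr => j _.
by rewrite linearZ !mxE mulrC.
Qed.

(** Existence: composing the orthogonal projection onto the span of B with the
    coordinates in that basis and then with the suitably scaled g is an isometry
    on the span, as it sends the columns of B to vectors with the same Gram
    matrix.  Uniqueness: any isometry f sends the columns of B to a basis of the
    image lattice whose Gram matrix, by polarization, is again that of B. *)
Lemma lattice_shape_basis (R : realType) (B : 'M[R]_(3, 2))
    (g : GL2 R) (c : R) :
  c != 0 -> (val g)^T *m val g = c ^+ 2 *: (B^T *m B) ->
  lattice_shape (mulmx B @` intpoints R 2) = shape_class g.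
Proof.
move=> c0 gE; set L := mulmx B @` _.
have ucg : c^-1 *: val g \in unitmx.
  by rewrite unitmxZ ?unit_val// unitfE invr_eq0.
pose h := mkGL2 ucg.
have hE : (val h)^T *m val h = B^T *m B.
  rewrite /= [(_ *: _)^T]linearZ /= -scalemxAl -scalemxAr gE !scalerA.
  by rewrite -expr2 exprVn mulVf ?scale1r// expf_neq0.
have uG : B^T *m B \in unitmx by rewrite -hE unitmx_mul unitmx_tr unit_val.
have spanE u : Rspan L u -> exists a, u = B *m a.
  move=> [k [a [w [Lw ->]]]].
  elim/big_ind: _ => [|_ _ [x ->] [y ->]|i _].
  - by exists 0; rewrite mulmx0.
  - by exists (x + y); rewrite mulmxDr.
  - by have [z _ <-] := Lw i; exists (a i *: z); rewrite scalemxAr.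
have shape_h : has_shape L (shape_class h).
  pose P := val h *m invmx (B^T *m B) *m B^T.
  have PB : P *m B = val h by rewrite -!mulmxA mulVmx// mulmx1.
  exists (mulmx P), h; split=> //.
  - move=> u /spanE[a ->] /=; rewrite mulmxA PB; congr Num.sqrt.
    by rewrite !dotE !trmx_mul -!mulmxA (mulmxA (val h)^T) (mulmxA B^T) hE.
  - rewrite /L /col_lattice image_comp; congr (_ @` _).
    by apply/funext => a /=; rewrite mulmxA PB.
have [f [k [fn fL ->]]] : has_shape L (lattice_shape L).
  exact: (xgetPex _ (ex_intro _ _ shape_h)).
pose F := \matrix_(i, j) f (col j B) i 0.
have FL : mulmx F @` intpoints R 2 = col_lattice k.
  rewrite -fL /L (image_comp (mulmx B)); congr (_ @` _); apply/funext => a /=.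
  by rewrite linear_colE.
have [gam ugam FE] := lattice_bases (unit_val k) FL.
have Rspan_col j : Rspan L (col j B).
  exists 1%N, (fun=> 1), (fun=> col j B); split=> [_|]; first exact: col_delta.
  by rewrite big_ord1 scale1r.
have Rspan_add i j : Rspan L (col i B + col j B).
  exists 2%N, (fun=> 1), (fun l => if l == 0 then col i B else col j B); split.
    by move=> l; case: ifP => _; apply: col_delta.
  by rewrite !big_ord_recl big_ord0 !scale1r addr0.
have fdot i j : dot (f (col i B)) (f (col j B)) = dot (col i B) (col j B).
  have fdd u : Rspan L u -> dot (f u) (f u) = dot u u.
    by move=> Lu; rewrite !dot_enorm fn.
  have := fdd _ (Rspan_add i j).
  by rewrite linearD !dotD !fdd//; lra.
have FB : F^T *m F = B^T *m B.
  apply/matrixP => i j; transitivity (dot (col i B) (col j B)).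
    by rewrite -fdot mxE; apply: eq_bigr => l _; rewrite !mxE.
  by rewrite mxE; apply: eq_bigr => l _; rewrite !mxE.
by apply: (shape_class_gram c0 ugam); rewrite -FE FB.
Qed.

(** * Integral pairs with cross product on the quadric *)

Definition vec3 {A : Type} (a b c : A) : 'cV[A]_3 :=
  \col_(i < 3) if i == 0 then a else if i == 1 then b else c.

Definition cross {A : pzRingType} (u v : 'cV[A]_3) : 'cV[A]_3 :=
  vec3 (u 1 0 * v 2 0 - u 2 0 * v 1 0) (u 2 0 * v 0 0 - u 0 0 * v 2 0)
       (u 0 0 * v 1 0 - u 1 0 * v 0 0).

Definition pair_mx {A : Type} (u v : 'cV[A]_3) : 'M[A]_(3, 2) :=
  \matrix_(i, j) if j == 0 then u i 0 else v i 0.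

Lemma vec3E (A : Type) (a b c : A) :
  (vec3 a b c 0 0 = a) * (vec3 a b c 1 0 = b) * (vec3 a b c 2 0 = c).
Proof. by rewrite !mxE. Qed.

Lemma ord3P (P : 'I_3 -> Prop) : P 0 -> P 1 -> P 2 -> forall i, P i.
Proof.
move=> P0 P1 P2 i; case: (unliftP 0 i) => [j|] -> //.
elim/ord2P: j.
  by rewrite (_ : lift _ _ = 1) //; apply/val_inj.
by rewrite (_ : lift _ _ = 2) //; apply/val_inj.
Qed.

Lemma sum3 (A : nmodType) (F : 'I_3 -> A) : \sum_i F i = F 0 + F 1 + F 2.
Proof.
rewrite !big_ord_recl big_ord0 addr0 addrA.
by congr (F _ + F _ + F _); apply/val_inj.
Qed.

Lemma sum2 (A : nmodType) (F : 'I_2 -> A) : \sum_i F i = F 0 + F 1.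
Proof.
rewrite !big_ord_recl big_ord0 addr0.
by congr (F _ + F _); apply/val_inj.
Qed.

Lemma lagrange_cross (R : realType) (u v : 'cV[R]_3) :
  dot (cross u v) (cross u v) = dot u u * dot v v - dot u v ^+ 2.
Proof. by rewrite /dot !sum3 !vec3E; ring. Qed.

(** Let w = u x v, and let w' = (w_2, - w_1, w_0) be half the gradient of the
    quadratic form at w, so that <w, w'> = 1.  Then u, v, w' have determinant
    1, and Cramer's rule writes an integral z as an integral combination
    a u + b v + <w, z> w', in which the last term vanishes when z is orthogonal
    to w. *)
Lemma Lambda_cross (R : realType) (u v : 'cV[int]_3) : HZ (cross u v) ->
  Lambda R (cross u v) = mulmx (map_mx intr (pair_mx u v)) @` intpoints R 2.
Proof.
rewrite /HZ /= => Hw; set w := cross u v in Hw *; apply/seteqP; split.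
- move=> x [+ [z _ zE]]; rewrite -{}zE /= => wz.
  have {}wz : w 0 0 * z 0 0 + w 1 0 * z 1 0 + w 2 0 * z 2 0 = 0.
    move: wz; rewrite /dot sum3 !mxE -!intrM -!intrD => /eqP.
    by rewrite intr_eq0 => /eqP.
  pose h (y : 'cV[int]_3) := w 2 0 * y 0 0 - w 1 0 * y 1 0 + w 0 0 * y 2 0.
  pose a : 'cV[int]_2 := \col_i if i == 0 then h (cross z v) else h (cross u z).
  exists (map_mx intr a); first by exists a.
  rewrite -map_mxM; congr map_mx; apply/colP => i.
  suff E : (2 * w 0 0 * w 2 0 - w 1 0 ^+ 2) * z i 0 =
      u i 0 * h (cross z v) + v i 0 * h (cross u z)
      + (w 0 0 * z 0 0 + w 1 0 * z 1 0 + w 2 0 * z 2 0) *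
        vec3 (w 2 0) (- w 1 0) (w 0 0) i 0.
    move: E; rewrite Hw wz mul0r addr0 mul1r => ->.
    by rewrite mxE sum2 !mxE.
  elim/ord3P: i; rewrite vec3E /h /w /cross !vec3E; ring.
- move=> x [t [a _ <-] <-]; split.
    rewrite /= /dot -map_mxM sum3 ![map_mx _ _ _ _]mxE -!intrM -!intrD.
    by apply/eqP; rewrite intr_eq0; apply/eqP; rewrite !mxE !sum2 !mxE /=; ring.
  by exists (pair_mx u v *m a) => //; rewrite map_mxM.
Qed.

Lemma dot_HZ_gt0 (R : realType) (v : 'cV[int]_3) : HZ v ->
  0 < dot (map_mx intr v : 'cV[R]_3) (map_mx intr v).
Proof.
rewrite /HZ /= => Hv; rewrite lt_neqAle dot_ge0 andbT eq_sym.
apply/eqP; rewrite /dot sum3 -!expr2 !mxE => /eqP.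
rewrite !paddr_eq0 ?addr_ge0 ?sqr_ge0// !sqrf_eq0 !intr_eq0.
by move=> /andP[/andP[/eqP v0 /eqP v1] _]; move: Hv; rewrite v0 v1 !mulr0 mul0r.
Qed.

Lemma map_cross (R : realType) (u v : 'cV[int]_3) :
  map_mx intr (cross u v) = cross (map_mx intr u) (map_mx intr v) :> 'cV[R]_3.
Proof.
apply/colP; elim/ord3P; rewrite ![map_mx _ _ _ _]mxE !vec3E !mxE.
all: by rewrite rmorphB !rmorphM.
Qed.

Definition shape_x {R : realType} (u v : 'cV[R]_3) : R := dot u v / dot u u.

Definition shape_y {R : realType} (u v : 'cV[R]_3) : R :=
  enorm (cross u v) / dot u u.

(** The positivity of the second coordinate is Lagrange's identity: the Gram
    determinant of u, v is |u x v|^2, which is nonzero on the quadric. *)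
Lemma shape_Lambda (R : realType) (u v : 'cV[int]_3)
    (u' := map_mx intr u : 'cV[R]_3) (v' := map_mx intr v : 'cV[R]_3) :
  HZ (cross u v) -> exists y0 : 0 < shape_y u' v',
  lattice_shape (Lambda R (cross u v)) = shape_class (triGL (shape_x u' v') y0).
Proof.
move=> Hw; have := dot_HZ_gt0 R Hw; rewrite map_cross -/u' -/v' => w0.
pose B := map_mx intr (pair_mx u v) : 'M[R]_(3, 2); pose G := B^T *m B.
have sG : G^T = G by rewrite trmx_mul trmxK.
have G00 : G 0 0 = dot u' u'.
  by rewrite mxE; apply: eq_bigr => i _; rewrite !mxE.
have G01 : G 0 1 = dot u' v'.
  by rewrite mxE; apply: eq_bigr => i _; rewrite !mxE.
have G11 : G 1 1 = dot v' v'.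
  by rewrite mxE; apply: eq_bigr => i _; rewrite !mxE.
have G10 : G 1 0 = dot u' v' by rewrite -sG mxE.
have uG : G \in unitmx.
  rewrite unitmxE det2 G00 G11 G01 G10 -expr2 -lagrange_cross unitfE.
  by rewrite gt_eqF.
have a0 : 0 < dot u' u' by rewrite -G00 gram00_gt0.
have y0 : 0 < shape_y u' v' by rewrite divr_gt0// sqrtr_gt0.
exists y0; rewrite Lambda_cross//.
apply: (@lattice_shape_basis _ _ _ (Num.sqrt (dot u' u'))^-1).
  by rewrite invr_eq0 gt_eqF// sqrtr_gt0.
rewrite exprVn sqr_sqrtr ?ltW// -/B -/G; apply: (gram_tri sG) => //.
by rewrite mulrC divfK ?gt_eqF// -dot_enorm lagrange_cross G11.
Qed.

(** * A family of lattices with explicit limit shapes *)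

(** In the notation of the introductory comment, these are l, j, k, a and m,
    together with c = (m - a j) / d, all made homogeneous in (n, d): the
    integers of the family are the values at d = 1, and dividing by the
    appropriate power of n gives the values at (1, 1 / n).  The limit n -> oo
    is thus the value of a polynomial at d = 0. *)
Definition fam_l {A : comPzRingType} (p q i n d : A) : A := p * q * n + i * d.

Definition fam_j {A : comPzRingType} (q n : A) : A := q ^+ 2 * n.

Definition fam_k {A : comPzRingType} (p q i n d : A) : A :=
  2 * fam_l p q i n d + d - fam_j q n.

Definition fam_a {A : comPzRingType} (p e n d : A) : A :=
  2 * p ^+ 2 * n + e * d.

Definition fam_m {A : comPzRingType} (p q i n d : A) : A :=
  2 * fam_l p q i n d ^+ 2 + 2 * fam_l p q i n d * d + d ^+ 2.

Definition fam_c {A : comPzRingType} (p q i e n d : A) : A :=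
  (4 * p * q * i + 2 * p * q - e * q ^+ 2) * n + (2 * i ^+ 2 + 2 * i + 1) * d.

(** The vector b = (2 (1 + j k), k - j, -1). *)
Definition fam1 {A : comPzRingType} (p q i n d : A) : 'cV[A]_3 :=
  let j := fam_j q n in let k := fam_k p q i n d in
  vec3 (2 * (d ^+ 2 + j * k)) (d * (k - j)) (- d ^+ 2).

(** The vector a b - (s + 2 k m, - m, 0), with s = 2 l + 1.  Its first
    coordinate contains 2 k (a j - m), whose terms of degree 3 in n cancel;
    writing it with fam_c makes both vectors homogeneous of degree 2. *)
Definition fam2 {A : comPzRingType} (p q i e n d : A) : 'cV[A]_3 :=
  let j := fam_j q n in let k := fam_k p q i n d in let a := fam_a p e n d in
  vec3 (2 * d * a - d * (2 * fam_l p q i n d + d)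
          - 2 * k * fam_c p q i e n d)
       (a * (k - j) + fam_m p q i n d) (- d * a).

(** The cross product is (m, s + 2 k m, 1 + 2 k s + 2 k^2 m) with s = 2 l + 1,
    the image of (m, s, 1) under an isometry of the quadratic form. *)
Lemma fam_HZ (p q i e n : int) :
  HZ (cross (fam1 p q i n 1) (fam2 p q i e n 1)).
Proof.
rewrite /HZ /= /cross !vec3E /fam_c /fam_m /fam_a /fam_k /fam_j /fam_l; ring.
Qed.

Lemma fam1_scale (R : realType) (p q i : int) (n : nat) : (0 < n)%N ->
  map_mx intr (fam1 p q i n%:Z 1) =
  n%:R ^+ 2 *: fam1 p%:~R q%:~R i%:~R 1 n%:R^-1 :> 'cV[R]_3.
Proof.
move=> n0; have n1 : n%:R != 0 :> R by rewrite pnatr_eq0 -lt0n.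
apply/colP; elim/ord3P; rewrite ![map_mx _ _ _ _]mxE [RHS]mxE !vec3E;
  rewrite /fam_c /fam_m /fam_a /fam_k /fam_j /fam_l.
all: rewrite ?(rmorphD, rmorphB, rmorphM, rmorphXn, rmorphN, rmorph1) /=.
all: rewrite -?pmulrn.
all: by field.
Qed.

Lemma fam2_scale (R : realType) (p q i e : int) (n : nat) : (0 < n)%N ->
  map_mx intr (fam2 p q i e n%:Z 1) =
  n%:R ^+ 2 *: fam2 p%:~R q%:~R i%:~R e%:~R 1 n%:R^-1 :> 'cV[R]_3.
Proof.
move=> n0; have n1 : n%:R != 0 :> R by rewrite pnatr_eq0 -lt0n.
apply/colP; elim/ord3P; rewrite ![map_mx _ _ _ _]mxE [RHS]mxE !vec3E;
  rewrite /fam_c /fam_m /fam_a /fam_k /fam_j /fam_l.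
all: rewrite ?(rmorphD, rmorphB, rmorphM, rmorphXn, rmorphN, rmorph1) /=.
all: rewrite -?pmulrn.
all: by field.
Qed.

Lemma dotZ (R : realType) n (c : R) (u v : 'cV[R]_n) :
  dot (c *: u) (c *: v) = c ^+ 2 * dot u v.
Proof.
by rewrite /dot mulr_sumr; apply: eq_bigr => i _; rewrite !mxE; ring.
Qed.

Lemma crossZ (R : realType) (c : R) (u v : 'cV[R]_3) :
  cross (c *: u) (c *: v) = c ^+ 2 *: cross u v.
Proof.
by apply/colP; elim/ord3P; rewrite [RHS]mxE !vec3E !mxE; ring.
Qed.

Lemma shape_xZ (R : realType) (c : R) (u v : 'cV[R]_3) : c != 0 ->
  shape_x (c *: u) (c *: v) = shape_x u v.
Proof.
by move=> c0; rewrite /shape_x !dotZ -mulf_div divff ?expf_neq0// mul1r.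
Qed.

Lemma shape_yZ (R : realType) (c : R) (u v : 'cV[R]_3) : c != 0 ->
  shape_y (c *: u) (c *: v) = shape_y u v.
Proof.
move=> c0; rewrite /shape_y /enorm crossZ !dotZ sqrtrM ?sqr_ge0// sqrtr_sqr.
rewrite ger0_norm ?sqr_ge0// -mulf_div divff ?expf_neq0//.
by rewrite mul1r.
Qed.

(** The coordinates are polynomial in d: they are the values at d of the same
    family formed over the polynomial ring at the indeterminate. *)
Lemma fam1_continuous (R : realType) (p q i : R) j :
  continuous (fun d : R => fam1 p q i 1 d j 0).
Proof.
rewrite (_ : (fun d => _) = horner (fam1 p%:P q%:P i%:P 1 'X j 0)).
  exact: continuous_horner.
apply/funext => d; move: j; elim/ord3P; rewrite !vec3E /fam_k /fam_j /fam_l;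
  by rewrite -?polyC_natr !hornerE ?horner_exp ?hornerE.
Qed.

Lemma fam2_continuous (R : realType) (p q i e : R) j :
  continuous (fun d : R => fam2 p q i e 1 d j 0).
Proof.
rewrite (_ : (fun d => _) = horner (fam2 p%:P q%:P i%:P e%:P 1 'X j 0)).
  exact: continuous_horner.
apply/funext => d; move: j; elim/ord3P;
  rewrite !vec3E /fam_c /fam_m /fam_a /fam_k /fam_j /fam_l;
  by rewrite -?polyC_natr !hornerE ?horner_exp ?hornerE.
Qed.

Lemma dot_continuous (R : realType) m (u v : R -> 'cV[R]_m) :
  (forall j, continuous (fun d => u d j 0)) ->
  (forall j, continuous (fun d => v d j 0)) ->
  continuous (fun d => dot (u d) (v d)).
Proof.
move=> cu cv; apply: continuous_big => [x|j _ d]; first exact: add_continuous.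
by apply: cvgM; [exact: cu|exact: cv].
Qed.

Lemma shape_continuous (R : realType) (u v : R -> 'cV[R]_3) (d : R) :
  (forall j, continuous (fun d => u d j 0)) ->
  (forall j, continuous (fun d => v d j 0)) -> dot (u d) (u d) != 0 ->
  {for d, continuous (fun d => shape_x (u d) (v d))} /\
  {for d, continuous (fun d => shape_y (u d) (v d))}.
Proof.
move=> cu cv u0; have cuu := dot_continuous cu cu.
have cuv := dot_continuous cu cv; have cvv := dot_continuous cv cv.
have cw : continuous (fun d => dot (cross (u d) (v d)) (cross (u d) (v d))).
  rewrite (_ : (fun _ => _) = (fun d => dot (u d) (u d) * dot (v d) (v d)
      - dot (u d) (v d) * dot (u d) (v d))); last first.
    by apply/funext => z; rewrite lagrange_cross expr2.
  move=> z; apply: cvgB; first by apply: cvgM; [exact: cuu|exact: cvv].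
  by apply: cvgM; exact: cuv.
split; apply: cvgM.
- exact: cuv.
- by apply: cvgV => //; exact: cuu.
- exact: (cvg_comp _ _ (cw d) (@sqrt_continuous R _)).
- by apply: cvgV => //; exact: cuu.
Qed.

(** At (n, d) = (1, 0) both vectors lie in the plane of the first two
    coordinates: they are (2 q^3 k, 0, 0) and (-2 q k c, 2 p^2 q k, 0) with
    k = 2 p - q and c = 4 p q i + 2 p q - e q^2. *)
Lemma fam_limit (R : realType) (p q i e : R) : q != 0 -> 2 * p != q ->
  [/\ dot (fam1 p q i 1 0) (fam1 p q i 1 0) != 0,
      shape_x (fam1 p q i 1 0) (fam2 p q i e 1 0) =
        e - 2 * p * (2 * i + 1) / q
    & shape_y (fam1 p q i 1 0) (fam2 p q i e 1 0) = (p / q) ^+ 2].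
Proof.
move=> q0 pq; pose k := 2 * p - q.
have k0 : k != 0 by rewrite subr_eq0.
have d11 : dot (fam1 p q i 1 0) (fam1 p q i 1 0) = (2 * q ^+ 3 * k) ^+ 2.
  rewrite /dot sum3 !vec3E /fam_k /fam_j /fam_l /k; ring.
have d11_0 : (2 * q ^+ 3 * k) ^+ 2 != 0.
  by rewrite expf_neq0// !mulf_neq0// ?expf_neq0// pnatr_eq0.
have wE : enorm (cross (fam1 p q i 1 0) (fam2 p q i e 1 0)) =
    (2 * q ^+ 2 * p * k) ^+ 2.
  rewrite -[RHS]ger0_norm ?sqr_ge0// -sqrtr_sqr; congr Num.sqrt.
  rewrite /dot sum3 /cross !vec3E /fam_c /fam_m /fam_a /fam_k /fam_j /fam_l /k.
  ring.
rewrite /shape_x /shape_y d11 wE; split=> //; last by field; rewrite q0 k0.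
rewrite (_ : dot _ _ = - (2 * q ^+ 2 * k) ^+ 2 *
    (4 * p * q * i + 2 * p * q - e * q ^+ 2)); first by field; rewrite q0 k0.
rewrite /dot sum3 !vec3E /fam_c /fam_m /fam_a /fam_k /fam_j /fam_l /k; ring.
Qed.

Lemma fam_approx (R : realType) (p q i e : int) (eps : R) :
  0 < eps -> q != 0 -> 2 * p != q ->
  exists u v : 'cV[int]_3, [/\ HZ (cross u v),
    `|shape_x (map_mx intr u) (map_mx intr v)
       - (e%:~R - 2 * p%:~R * (2 * i%:~R + 1) / q%:~R)| < eps
  & `|shape_y (map_mx intr u) (map_mx intr v)
       - (p%:~R / q%:~R) ^+ 2| < eps].
Proof.
move=> eps0 q0 pq.
have q0R : q%:~R != 0 :> R by rewrite intr_eq0.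
have pqR : 2 * p%:~R != q%:~R :> R.
  by rewrite -[2]/(2%:~R) -intrM eqr_int.
have [u0 xE yE] := fam_limit i%:~R e%:~R q0R pqR.
have [cx cy] := shape_continuous (@fam1_continuous R p%:~R q%:~R i%:~R)
  (@fam2_continuous R p%:~R q%:~R i%:~R e%:~R) u0.
have harm := @cvg_harmonic R.
have /cvgrPdist_lt/(_ _ eps0) hx := cvg_comp _ _ harm cx.
have /cvgrPdist_lt/(_ _ eps0) hy := cvg_comp _ _ harm cy.
have [n [/= nx ny]] := filter_ex (filterI hx hy).
exists (fam1 p q i n.+1%:Z 1), (fam2 p q i e n.+1%:Z 1).
rewrite fam1_scale// fam2_scale// shape_xZ ?shape_yZ ?expf_neq0 ?pnatr_eq0//.
by split; [exact: fam_HZ|rewrite -xE distrC|rewrite -yE distrC].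
Qed.

(** * Density of the limit shapes *)

(** Of the two consecutive integers next to t, at most one is divisible by q. *)
Lemma near_coprime (R : realType) (t : R) (q : nat) : prime q ->
  exists2 p : int, coprimez p q & `|p%:~R - t| <= 1.
Proof.
move=> pq; pose f := Num.floor t.
have ft : (f%:~R : R) <= t by exact: floor_le.
have tf : t < (f%:~R : R) + 1 by have := floorD1_gt t; rewrite intrD.
have cop (z : int) : coprimez z q = ~~ (q %| z)%Z.
  by rewrite coprimezE coprime_sym absz_nat prime_coprime// dvdzE.
have [qf|qf] := boolP (q %| f)%Z; [exists (f + 1)|exists f]; rewrite ?cop//.
- rewrite rpredDl// dvdzE; apply/negP => /(dvdn_leq (ltn0Sn _)).
  by rewrite leqNgt prime_gt1.
- by rewrite intrD ler_norml; apply/andP; split; lra.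
- by rewrite ler_norml; apply/andP; split; lra.
Qed.

(** A relation a (4 p) + b q = 1 gives i and e with e q - 2 p (2 i + 1) equal to
    the integral part N of x q, so that the first value is N / q. *)
Lemma rational_approx (R : realType) (x s eps : R) : 0 <= s -> 0 < eps ->
  exists p q i e : int, [/\ q != 0, 2 * p != q,
    `|e%:~R - 2 * p%:~R * (2 * i%:~R + 1) / q%:~R - x| < eps
  & `|(p%:~R / q%:~R) ^+ 2 - s ^+ 2| < eps].
Proof.
move=> s0 eps0.
have [q qlt pq] := prime_above (Num.bound ((2 * s + 1) / eps)).+2.
have q2 : (2 < q)%N by apply: leq_trans qlt; rewrite !ltnS.
have oq : odd q by have [q2E|//] := even_prime pq; rewrite q2E in q2.
have q1R : 1 < q%:R :> R by rewrite ltr1n prime_gt1.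
have q0R : 0 < q%:R :> R by apply: lt_trans q1R.
have qs : (2 * s + 1) / q%:R < eps.
  rewrite ltr_pdivrMr// [eps * _]mulrC -ltr_pdivrMr//.
  apply: (lt_trans (archi_boundP _)); first by apply: divr_ge0; lra.
  by rewrite ltr_nat (leq_trans _ qlt)// !ltnS leqW.
have [p cpq pE] := near_coprime (s * q%:R) pq.
have c4 : coprimez (4 * p) q.
  rewrite coprimezMl cpq andbT coprimezE (@coprimeXl 2 2 q)//.
  by rewrite coprime2n.
have /coprimezP[[a b] /= abE] := c4.
pose N := Num.floor (x * q%:R).
have Nx : (N%:~R : R) <= x * q%:R by exact: floor_le.
have xN : x * q%:R < (N%:~R : R) + 1.
  by have := floorD1_gt (x * q%:R); rewrite intrD.
exists p, q, (- a * (N + 2 * p)), (b * (N + 2 * p)); split.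
- by rewrite eqz_nat -lt0n prime_gt0.
- apply/eqP => pq2; move: oq; rewrite -[q]absz_nat -pq2 abszM oddM.
  by [].
- have -> : (b * (N + 2 * p))%:~R - 2 * p%:~R *
      (2 * (- a * (N + 2 * p))%:~R + 1) / (q : int)%:~R = N%:~R / q%:R :> R.
    have E : (b * (N + 2 * p) * q
        - 2 * p * (2 * (- a * (N + 2 * p)) + 1) = N :> int).
      transitivity ((a * (4 * p) + b * q) * (N + 2 * p) - 2 * p); first by ring.
      by rewrite abE; ring.
    rewrite -[in RHS]E !(intrD, intrM, intrB, rmorphN) /= -!pmulrn.
    by field; rewrite gt_eqF.
  apply: le_lt_trans qs; rewrite -(ler_pM2r q0R) divfK ?gt_eqF//.
  rewrite -{2}[q%:R]gtr0_norm// -normrM mulrBl divfK ?gt_eqF//.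
  by rewrite ler_norml; apply/andP; split; lra.
- rewrite -pmulrn.
  have : `|p%:~R / q%:R - s| <= q%:R^-1 :> R.
    rewrite -(ler_pM2r q0R) mulVf ?gt_eqF// -{2}[q%:R]gtr0_norm// -normrM.
    by rewrite mulrBl divfK ?gt_eqF.
  set r := _ / _; set d := _^-1 => rd.
  have d1 : d <= 1 by rewrite invf_le1// ltW.
  rewrite subr_sqr normrM; apply: le_lt_trans qs.
  rewrite mulrC ler_pM ?normr_ge0//.
  move: rd; rewrite !ler_norml => /andP[? ?]; apply/andP; split; lra.
Qed.

Lemma integer_approx (R : realType) (x y eps : R) : 0 < y -> 0 < eps ->
  exists u v : 'cV[int]_3, [/\ HZ (cross u v),
    `|shape_x (map_mx intr u) (map_mx intr v) - x| < eps
  & `|shape_y (map_mx intr u) (map_mx intr v) - y| < eps].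
Proof.
move=> y0 eps0; have e20 : 0 < eps / 2 by rewrite divr_gt0.
have [p [q [i [e [q0 pq xE]]]]] := rational_approx x (sqrtr_ge0 y) e20.
rewrite sqr_sqrtr ?ltW// => yE.
have [u [v [H xuv yuv]]] := fam_approx i e e20 q0 pq.
exists u, v; split=> //.
- have := ler_normD (shape_x (map_mx intr u) (map_mx intr v)
    - (e%:~R - 2 * p%:~R * (2 * i%:~R + 1) / q%:~R))
    (e%:~R - 2 * p%:~R * (2 * i%:~R + 1) / q%:~R - x).
  by rewrite addrA subrK; lra.
- have := ler_normD (shape_y (map_mx intr u) (map_mx intr v)
    - (p%:~R / q%:~R) ^+ 2) ((p%:~R / q%:~R) ^+ 2 - y).
  by rewrite addrA subrK; lra.
Qed.

Theorem mainTheorem4 (R : realType) :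
  dense [set lattice_shape (Lambda R v) | v in HZ].
Proof.
move=> U [s Us] oU.
pose W := [set g : GL2 R | U (shape_class g)].
have oW : open W by exact: oU.
have [V oV VW] := oW.
have [x [y [y0 gE]]] := shape_class_tri (repr (repr s : X2 R)).
have Vtri : V (tri x y).
  have : W (triGL x y0) by rewrite /W /= -gE /shape_class !reprK.
  by rewrite -VW.
have /nbhs_ballP[eps /= eps0 sub] : nbhs (tri x y) V by exact: open_nbhs_nbhs.
have [u [v [Huv xE yE]]] := integer_approx x y0 eps0.
have [z0 shE] := shape_Lambda R Huv.
exists (lattice_shape (Lambda R (cross u v))); split; last first.
  by exists (cross u v).
rewrite shE.
suff : W (triGL (shape_x (map_mx intr u) (map_mx intr v)) z0) by [].
rewrite -VW /=; apply: sub; split=> // i j; rewrite !mxE /ball /= /ball_ distrC.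
by case: ifP; case: ifP; rewrite ?subrr ?normr0.
Qed.
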